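(* Let $X$ be an $n$-configuration in the Euclidean space $\mathbb{R}^k$ with centroid at the origin, and let $\varepsilon\geq 0$. Then the set $\mathrm{Sym}_\varepsilon(X)$ is a compact $K$-approximate subgroup of the orthogonal group $O(k)$ for some finite $K$.
   Context: An $n$-configuration is a subset of $n$ distinct points. Fix $p\geq 1$. For $n$-configurations $X,Y$ the $p$-Wasserstein distance is $W_p(X,Y)=\big(\inf_\gamma\sum_{x\in X}\|x-\gamma(x)\|^p\big)^{1/p}$ over all bijections $\gamma:X\to Y$. For $\pi\in O(k)$ put $\widetilde\mu(X,\pi)=W_p(X,\pi(X))$, and for $\varepsilon\geq0$ let $$\mathrm{Sym}_\varepsilon(X)=\{\pi\in O(k)\mid\widetilde\mu(X,\pi)\leq\varepsilon\}.$$ A non-empty subset $A$ of a locally compact topological group $G$ is a $K$-approximate subgroup if: (i) $A=A^{-1}$; (ii) $A$ contains the identity element; (iii) there is a finite subset $F\subseteq G$ of cardinality at most $K$ such that $A\cdot A\subseteq F\cdot A$. It is a compact $K$-approximate subgroup if moreover $A$ is compact. *)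

(* Defs.v *)
From HB Require Import structures.
From mathcomp Require Import all_boot all_order all_algebra.
From mathcomp Require Import all_classical all_reals all_analysis.

Set Implicit Arguments.
Unset Strict Implicit.
Unset Printing Implicit Defensive.

Import Order.TTheory GRing.Theory Num.Theory.
Import numFieldNormedType.Exports.

Local Open Scope classical_set_scope.
Local Open Scope ring_scope.

(* Locally compact topological groups in multiplicative notation; no separation
   axiom is imposed. *)
HB.mixin Record isLCTopologicalGroup G of Topological G & Group G := {
  mulg_continuous : continuous (fun x : G * G => (x.1 * x.2)%g) ;
  invg_continuous : continuous (fun x : G => x^-1%g) ;
  lcgroup_locally_compact : locally_compact [set: G]
}.

#[short(type="lcGroupType")]
HB.structure Definition LCTopologicalGroup :=
  {G of Topological G & Group G & isLCTopologicalGroup G}.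

(* [F] is a finite set with at most [K] elements: [`I_K] is {0, ..., K - 1} and
   [#<=] compares cardinals. *)
Definition approximate_subgroup (G : lcGroupType) (K : nat) (A : set G) : Prop :=
  [/\ A !=set0,
      A = [set x^-1%g | x in A],
      A 1%g &
      exists2 F : set G, (F #<= `I_K)%card &
        [set (x * y)%g | x in A & y in A] `<=`
        [set (f * y)%g | f in F & y in A]].

Definition compact_approximate_subgroup (G : lcGroupType) (K : nat)
    (A : set G) : Prop :=
  approximate_subgroup K A /\ compact A.

Section orthogonal_group.
Variables (R : realType) (k : nat).

(* The orthogonal group O(k), as a type of matrices; it is given below the
   matrix product, the transpose as inverse, and the topology induced by the
   inclusion into the space of k x k matrices. *)
Record orthogonal := Orthogonal {
  orthogonal_mx :> 'M[R]_k ;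
  orthogonal_mxP : orthogonal_mx *m orthogonal_mx^T == 1%:M
}.

HB.instance Definition _ := [isSub for orthogonal_mx].
HB.instance Definition _ := [Choice of orthogonal by <:].

Implicit Types f g h : orthogonal.

Lemma orthogonal_mulmxV f : f *m (f : 'M[R]_k)^T = 1%:M.
Proof. exact/eqP/(orthogonal_mxP f). Qed.

Lemma orthogonal_mulVmx f : (f : 'M[R]_k)^T *m f = 1%:M.
Proof. exact/mulmx1C/orthogonal_mulmxV. Qed.

Lemma orthogonal_one_subproof : (1%:M : 'M[R]_k) *m (1%:M)^T == 1%:M.
Proof. by rewrite trmx1 mulmx1. Qed.

Lemma orthogonal_mul_subproof f g :
  ((f : 'M[R]_k) *m g) *m ((f : 'M[R]_k) *m g)^T == 1%:M.
Proof.
by rewrite trmx_mul mulmxA -(mulmxA (f : 'M[R]_k)) orthogonal_mulmxV mulmx1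
  orthogonal_mulmxV.
Qed.

Lemma orthogonal_inv_subproof f : (f : 'M[R]_k)^T *m (f : 'M[R]_k)^T^T == 1%:M.
Proof. by rewrite trmxK orthogonal_mulVmx. Qed.

Definition orthogonal_one := Orthogonal orthogonal_one_subproof.
Definition orthogonal_mul f g := Orthogonal (orthogonal_mul_subproof f g).
Definition orthogonal_inv f := Orthogonal (orthogonal_inv_subproof f).

Lemma orthogonal_mulA : associative orthogonal_mul.
Proof. by move=> f g h; apply/val_inj; rewrite /= mulmxA. Qed.

Lemma orthogonal_mul1 : left_id orthogonal_one orthogonal_mul.
Proof. by move=> f; apply/val_inj; rewrite /= mul1mx. Qed.

Lemma orthogonal_mulr1 : right_id orthogonal_one orthogonal_mul.
Proof. by move=> f; apply/val_inj; rewrite /= mulmx1. Qed.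

Lemma orthogonal_mulV :
  left_inverse orthogonal_one orthogonal_inv orthogonal_mul.
Proof. by move=> f; apply/val_inj; rewrite /= orthogonal_mulVmx. Qed.

Lemma orthogonal_mulrV :
  right_inverse orthogonal_one orthogonal_inv orthogonal_mul.
Proof. by move=> f; apply/val_inj; rewrite /= orthogonal_mulmxV. Qed.

HB.instance Definition _ := isGroup.Build orthogonal orthogonal_mulA
  orthogonal_mul1 orthogonal_mulr1 orthogonal_mulV orthogonal_mulrV.

HB.instance Definition _ :=
  Topological.copy orthogonal (initial_topology orthogonal_mx).

Lemma orthogonal_mx_continuous : continuous orthogonal_mx.
Proof. exact: (@initial_continuous orthogonal _ orthogonal_mx). Qed.

Lemma cvg_mx_coord m n (F : set_system 'M[R]_(m, n)) (M : 'M[R]_(m, n)) :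
  Filter F -> (forall i j, (fun N : 'M[R]_(m, n) => N i j) @ F --> M i j) ->
  F --> M.
Proof.
move=> FF FM; apply/cvg_mx_entourageP => A entA.
apply: (@filter_forall _ _ (fun i (N : 'M[R]_(m, n)) =>
  forall j, (M i j, N i j) \in A)) => i.
apply: (@filter_forall _ _ (fun j (N : 'M[R]_(m, n)) =>
  (M i j, N i j) \in A)) => j.
have /cvg_entourageP/(_ A entA) := FM i j.
by apply: (@filterS _ F) => N NA; exact/mem_set.
Qed.

Lemma cvg_orthogonal (F : set_system orthogonal) f : Filter F ->
  (forall i j, (fun g => (g : 'M[R]_k) i j) @ F --> (f : 'M[R]_k) i j) -> F --> f.
Proof.
move=> FF Ff B [_ [[C Cop <-] Cf] CB].
have mxF : orthogonal_mx @ F --> (f : 'M[R]_k).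
  by apply: cvg_mx_coord => i j; exact: Ff.
by apply: (@filterS _ F _ _ _ CB); apply: mxF; exact: open_nbhs_nbhs.
Qed.

Lemma orthogonal_coord_continuous i j :
  continuous (fun f : orthogonal => (f : 'M[R]_k) i j).
Proof.
move=> f; apply: (@continuous_comp _ _ _ orthogonal_mx (fun M : 'M[R]_k => M i j)).
  exact: orthogonal_mx_continuous.
exact: coord_continuous.
Qed.

Lemma orthogonal_mul_continuous :
  continuous (fun x : orthogonal * orthogonal => (x.1 * x.2)%g).
Proof.
move=> x; apply: cvg_orthogonal => i j.
pose mulE (y : orthogonal * orthogonal) : R :=
  \sum_l (y.1 : 'M[R]_k) i l * (y.2 : 'M[R]_k) l j.
have mulEE : (fun y : orthogonal * orthogonal =>
    ((y.1 * y.2)%g : orthogonal) i j) = mulE.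
  by apply/funext => y; rewrite mxE.
suff : mulE @ x --> mulE x by rewrite -mulEE.
apply: cvg_big => [|l _]; first exact: add_continuous; apply: cvgM.
- apply: (@continuous_comp _ _ _ fst (fun f : orthogonal => (f : 'M[R]_k) i l)).
    exact: cvg_fst.
  exact: orthogonal_coord_continuous.
- apply: (@continuous_comp _ _ _ snd (fun f : orthogonal => (f : 'M[R]_k) l j)).
    exact: cvg_snd.
  exact: orthogonal_coord_continuous.
Qed.

Lemma orthogonal_inv_continuous : continuous (fun f : orthogonal => f^-1%g).
Proof.
move=> f; apply: cvg_orthogonal => [|i j].
  exact/fmap_filter/nbhs_filter.
have invE : (fun g : orthogonal => (g^-1%g : orthogonal) i j) =
    (fun g => (g : 'M[R]_k) j i).
  by apply/funext => g; rewrite mxE.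
suff : (fun g : orthogonal => (g : 'M[R]_k) j i) @ f --> (f : 'M[R]_k) j i.
  by rewrite -invE mxE.
exact: orthogonal_coord_continuous.
Qed.

Lemma orthogonal_coord_le1 f i j : `|(f : 'M[R]_k) i j| <= 1.
Proof.
have := orthogonal_mulmxV f => /matrixP/(_ i i); rewrite !mxE eqxx mulr1n.
under eq_bigr do rewrite mxE -expr2.
rewrite (bigD1 j)//= => sumE.
rewrite -(@ler_sqr _ `|_|) ?nnegrE// expr1n real_normK ?num_real//.
by rewrite -sumE lerDl sumr_ge0// => l _; exact: sqr_ge0.
Qed.

Lemma orthogonal_compact : compact [set: orthogonal].
Proof.
pose B := [set v : 'rV[R]_(k * k) |
  forall i, `[(-1 : R), 1]%classic (v ord0 i)].
have Bc : compact B.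
  apply: (@rV_compact _ _ (fun=> `[(-1 : R), 1]%classic)) => _.
  exact: segment_compact.
rewrite compact_ultra => F FU _.
pose toB (f : orthogonal) : 'rV[R]_(k * k) := mxvec f.
have FB : F (toB @^-1` B).
  apply: filterE => f i /=; case/mxvec_indexP: i => i j.
  by rewrite /toB mxvecE in_itv/= -ler_norml; exact: orthogonal_coord_le1.
have [v [_ clv]] := Bc (toB @ F) _ FB.
have vF : toB @ F --> v.
  move=> U vU; have [//|FC] := in_ultra_setVsetC (toB @^-1` U) FU.
  by have [w [nUw Uw]] := clv (~` U) U FC vU; exfalso; exact: nUw.
pose M : 'M[R]_k := vec_mx v.
have FM i j : (fun f : orthogonal => (f : 'M[R]_k) i j) @ F --> M i j.
  rewrite mxE; under eq_fun do rewrite -mxvecE.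
  apply: (@cvg_comp _ _ _ toB (fun w : 'rV_(k * k) => w ord0 (mxvec_index i j))).
    exact: vF.
  exact: coord_continuous.
have MO : M *m M^T == 1%:M.
  apply/eqP/matrixP => i j.
  have : (fun f : orthogonal => ((f : 'M[R]_k) *m (f : 'M[R]_k)^T) i j) @ F -->
      (M *m M^T) i j.
    rewrite mxE; under eq_fun do rewrite mxE.
    apply: cvg_big => [|l _]; first exact: add_continuous.
    rewrite [_^T _ _]mxE; under eq_fun do rewrite [_^T _ _]mxE.
    by apply: cvgM; exact: FM.
  under eq_fun do rewrite orthogonal_mulmxV.
  by move=> /(cvg_unique _ (cvg_cst _)) ->.
by exists (Orthogonal MO); split=> //; apply: cvg_orthogonal => i j; exact: FM.
Qed.

Lemma orthogonal_locally_compact : locally_compact [set: orthogonal].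
Proof.
move=> f _; exists setT; first exact: filterT.
by split; [exact: orthogonal_compact | exact: closedT].
Qed.

HB.instance Definition _ := isLCTopologicalGroup.Build orthogonal
  orthogonal_mul_continuous orthogonal_inv_continuous
  orthogonal_locally_compact.

End orthogonal_group.

Section configurations.
Variables (R : realType) (k : nat).
Implicit Types (X Y : set 'cV[R]_k) (p eps : R) (pi : orthogonal R k).

Definition configuration (n : nat) X : Prop := (X #= `I_n)%card.

(* The library norm [`|v|] on matrices is the sup norm, hence this definition. *)
Definition euclidean_norm (v : 'cV[R]_k) : R :=
  Num.sqrt (\sum_(i < k) v i ord0 ^+ 2).

(* Meaningful when [X] is an n-configuration; the sum ranges over the finite
   set [X], and is zero by convention when [n = 0]. *)
Definition centroid (n : nat) X : 'cV[R]_k := n%:R^-1 *: \sum_(x \in X) x.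

(* Bijections X -> Y are represented by total functions whose restriction to X
   is a bijection onto Y; only their values on X enter the sum.  For two
   n-configurations the set of costs is non-empty and bounded below, so that
   [inf] is the actual infimum. *)
Definition wasserstein p X Y : R :=
  (inf [set \sum_(x \in X) (euclidean_norm (x - gamma x) `^ p)
       | gamma in set_bij X Y]) `^ p^-1.

Definition orthogonal_image pi X : set 'cV[R]_k :=
  [set (pi : 'M[R]_k) *m x | x in X].

Definition asymmetry p X pi : R := wasserstein p X (orthogonal_image pi X).

Definition approximate_symmetries p eps X : set (orthogonal R k) :=
  [set pi | asymmetry p X pi <= eps].

End configurations.

(* Main.v *)
From HB Require Import structures.
Require Import Defs.
From mathcomp Require Import all_boot all_order all_algebra.
From mathcomp Require Import all_classical all_reals all_analysis.
From mathcomp Require Import perm finmap.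

Import Order.TTheory GRing.Theory Num.Theory.
Import numFieldNormedType.Exports.
Local Open Scope classical_set_scope.
Local Open Scope ring_scope.

(** Fix an enumeration [e] of the n points.  The bijections from X to pi(X) are
    then the maps [e i |-> pi (e (s i))] for s a permutation of the indices, so
    the Wasserstein infimum is a minimum over the finite symmetric group, and pi
    belongs to Sym_eps(X) exactly when one of the finitely many costs
      cost s pi = sum_i || e i - pi (e (s i)) ||^p
    is at most eps^p ([asymmetry_leP]).  Everything is read off these costs.

    - As pi is an isometry, cost s^-1 pi^-1 = cost s pi, whence the symmetry of
      Sym_eps(X); and cost 1 1 = 0, whence the identity.
    - Each cost is continuous in pi, so Sym_eps(X) is a finite union of closed
      subsets of the compact group O(k), hence compact.
    - If eps > 0, the inequality cost 1 pi < eps^p defines a neighbourhood of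
      the identity contained in A = Sym_eps(X).  The compact set A A is covered
      by finitely many translates of the interior of A
      ([compact_nbhs1_approximate_subgroup]).
    - If eps = 0, then A need not be a neighbourhood of the identity; but a zero
      cost means that pi permutes X, so that A is a subgroup and one translate
      suffices ([compact_subgroup_approximate_subgroup]). *)

(** * Approximate subgroups of locally compact groups *)

Lemma mulgl_continuous (G : lcGroupType) (g : G) :
  continuous (fun x : G => (g * x)%g).
Proof.
move=> x; apply: (@cvg_comp _ _ _ (fun y => (g, y)) (fun y => (y.1 * y.2)%g)).
  apply: (@cvg_pair _ _ _ _ (nbhs g) (nbhs x)); first exact: cvg_cst.
  exact: cvg_id.
exact: (@mulg_continuous G (g, x)).
Qed.

(** The open-cover form of compactness is stated for pointed spaces; a group is
    pointed by its identity, and both notions depend on the topology alone. *)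
Lemma lcgroup_compact_cover (G : lcGroupType) : @compact G = @cover_compact G.
Proof.
pose pG : ptopologicalType := HB.pack_for ptopologicalType
  (LCTopologicalGroup.sort G) (isPointed.Build G 1%g).
exact: (@compact_cover pG).
Qed.

(** The translates [g A°] with [g] ranging over the group cover the compact set
    [A A], because [A°] contains the identity. *)
Lemma compact_nbhs1_approximate_subgroup (G : lcGroupType) (A : set G) :
  compact A -> nbhs 1%g A -> A = [set x^-1%g | x in A] ->
  exists K : nat, compact_approximate_subgroup K A.
Proof.
move=> Ac A1 Ainv.
have A1' : A 1%g by exact: nbhs_singleton.
have AAE : [set (x * y)%g | x in A & y in A] =
    (fun x : G * G => (x.1 * x.2)%g) @` (A `*` A).
  apply/seteqP; split=> [_ [x Ax [y Ay <-]]|_ [[x y] [/= Ax Ay] <-]].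
    by exists (x, y).
  by exists x => //; exists y.
have : compact ((fun x : G * G => (x.1 * x.2)%g) @` (A `*` A)).
  apply: continuous_compact; last exact: compact_setX.
  by apply: continuous_subspaceT; exact: mulg_continuous.
rewrite -AAE lcgroup_compact_cover.
move=> /(_ G setT (fun g => (fun x => (g^-1 * x)%g) @^-1` interior A)).
case=> [g _|x _|F _ Fcov].
- by apply: open_comp => [x _|]; [exact: mulgl_continuous|exact: open_interior].
- by exists x => //=; rewrite mulVg.
have /finite_setP[K FK] := finite_fset F.
exists K; split=> //; split=> //; first by exists 1%g.
exists [set` F]; first by rewrite (card_le_eql FK).
move=> x /Fcov[g Fg /interior_subset Agx]; exists g => //.
by exists (g^-1 * x)%g; rewrite // mulVKg.
Qed.

Lemma compact_subgroup_approximate_subgroup (G : lcGroupType) (A : set G) :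
  compact A -> A 1%g -> A = [set x^-1%g | x in A] ->
  (forall x y, A x -> A y -> A (x * y)%g) -> compact_approximate_subgroup 1%N A.
Proof.
move=> Ac A1 Ainv AM; split=> //; split=> //; first by exists 1%g.
exists [set 1%g]; first by rewrite (card_le_eql card_set1).
move=> _ [x Ax [y Ay <-]]; exists 1%g => //.
by exists (x * y)%g; [exact: AM|rewrite mul1g].
Qed.

(** * Powers and finite minima *)

(** The absolute value is essential at 0: the power function takes the value 1
    at every negative number. *)
Lemma powR_norm_continuous (R : realType) (p : R) :
  0 < p -> continuous (fun x : R => `|x| `^ p).
Proof.
move=> p0 x; have [->|x0] := eqVneq x 0.
  rewrite /continuous_at normr0 powR0 ?gt_eqF//.
  apply/cvgr0Pnorm_lt => e e0; near=> y.
  rewrite ger0_norm ?powR_ge0//.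
  (* |y| ^ p < e = (e ^ p^-1) ^ p as soon as |y| < e ^ p^-1 *)
  rewrite -[ltRHS]powRr1 ?(ltW e0)// -(@mulVf _ p) ?gt_eqF// powRrM.
  rewrite gt0_ltr_powR ?nnegrE ?powR_ge0//.
  by near: y; apply: (@nbhs0_lt _ R^o); rewrite powR_gt0.
apply: (@continuous_comp R R R (fun x : R => `|x|) (fun y => y `^ p)).
  exact: norm_continuous.
apply/differentiable_continuous/derivable1_diffP/derivable_powR.
by rewrite in_itv/= normr_gt0 x0.
Unshelve. all: by end_near. Qed.

Lemma inf_range_attained {R : realType} {T : finType} (t0 : T) (f : T -> R) :
  exists2 t, inf (range f) = f t & forall u, f t <= f u.
Proof.
have [t _ tmin] := arg_minP f (erefl : xpredT t0).
have lb : lbound (range f) (f t) by move=> _ [u _ <-]; exact: tmin.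
exists t; last by move=> u; exact: tmin.
apply/eqP; rewrite eq_le lb_le_inf ?andbT//; last by exists (f t), t.
by apply: ge_inf; [exists (f t)|exists t].
Qed.

(** * Matchings of a configuration with its image *)

Lemma configuration_enum (R : realType) (k n : nat) (X : set 'cV[R]_k) :
  configuration n X -> exists2 e : 'I_n -> 'cV[R]_k, injective e & X = range e.
Proof.
move=> /card_esym; rewrite (card_eql card_II) => /card_set_bijP[e].
move=> [eX eI eS]; exists e; first by move=> i j; apply: eI; rewrite in_setT.
by apply/seteqP; split=> [x /eS//|_ [i _ <-]]; exact: eX.
Qed.

Section matchings.
Context {R : realType} {k n : nat}.
Implicit Types (pi : Defs.orthogonal R k) (v : 'cV[R]_k) (s : {perm 'I_n}).

Lemma euclidean_norm0 : euclidean_norm (0 : 'cV[R]_k) = 0.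
Proof. by rewrite /euclidean_norm big1 ?sqrtr0// => i _; rewrite mxE expr0n. Qed.

Lemma euclidean_norm_eq0 v : euclidean_norm v = 0 -> v = 0.
Proof.
move/eqP; rewrite sqrtr_eq0 => v0; apply/colP => i; rewrite mxE.
apply/eqP; rewrite -sqrf_eq0; apply/eqP.
apply: (psumr_eq0P (P := xpredT) (F := fun i => v i ord0 ^+ 2)) => //.
  by move=> j _; exact: sqr_ge0.
by apply/eqP; rewrite eq_le v0 sumr_ge0// => j _; exact: sqr_ge0.
Qed.

Lemma euclidean_normN v : euclidean_norm (- v) = euclidean_norm v.
Proof.
by rewrite /euclidean_norm; under eq_bigr do rewrite mxE sqrrN.
Qed.

Lemma euclidean_norm_orthogonal pi v :
  euclidean_norm ((pi : 'M[R]_k) *m v) = euclidean_norm v.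
Proof.
have normE (u : 'cV[R]_k) : \sum_(i < k) u i ord0 ^+ 2 = (u^T *m u) ord0 ord0.
  by rewrite mxE; apply: eq_bigr => i _; rewrite mxE expr2.
rewrite /euclidean_norm !normE trmx_mul mulmxA -(mulmxA v^T).
by rewrite orthogonal_mulVmx mulmx1.
Qed.

Definition matching_cost (p : R) (e : 'I_n -> 'cV[R]_k) pi s : R :=
  \sum_(i < n) euclidean_norm (e i - (pi : 'M[R]_k) *m e (s i)) `^ p.

Variables (p : R) (e : 'I_n -> 'cV[R]_k).
Hypotheses (p_gt0 : 0 < p) (e_inj : injective e).

Lemma matching_cost_ge0 pi s : 0 <= matching_cost p e pi s.
Proof. by apply: sumr_ge0 => i _; exact: powR_ge0. Qed.

(** Applying the isometry [pi] turns each term [e (s i) - pi^-1 (e i)] into the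
    opposite of [e i - pi (e (s i))]. *)
Lemma matching_costV pi s :
  matching_cost p e pi^-1%g s^-1%g = matching_cost p e pi s.
Proof.
rewrite /matching_cost [LHS](reindex_inj (@perm_inj _ s))/=.
apply: eq_bigr => i _.
rewrite permK -(euclidean_norm_orthogonal pi) mulmxBr mulmxA.
by rewrite orthogonal_mulmxV mul1mx -opprB euclidean_normN.
Qed.

Lemma matching_cost_eq0P pi s :
  matching_cost p e pi s = 0 <-> forall i, e i = (pi : 'M[R]_k) *m e (s i).
Proof.
split=> [c0 i|es]; last first.
  rewrite /matching_cost big1// => i _.
  by rewrite -es subrr euclidean_norm0 powR0// gt_eqF.
apply/eqP; rewrite -subr_eq0; apply/eqP/euclidean_norm_eq0/(@powR_eq0_eq0 _ _ p).
by apply: (psumr_eq0P _ c0) => // j _; exact: powR_ge0.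
Qed.

Lemma matching_cost11 : matching_cost p e 1%g 1%g = 0.
Proof. by apply/matching_cost_eq0P => i; rewrite perm1 mul1mx. Qed.

Lemma matching_cost_eq0M pi1 pi2 s1 s2 :
  matching_cost p e pi1 s1 = 0 -> matching_cost p e pi2 s2 = 0 ->
  matching_cost p e (pi1 * pi2)%g (s1 * s2)%g = 0.
Proof.
move=> /matching_cost_eq0P es1 /matching_cost_eq0P es2.
by apply/matching_cost_eq0P => i; rewrite permM -mulmxA -es2 -es1.
Qed.

Lemma matching_cost_continuous s : continuous (matching_cost p e ^~ s).
Proof.
move=> pi; have FF : Filter (nbhs pi) by exact: nbhs_filter.
have Fpi a b : (fun q : Defs.orthogonal R k => (q : 'M[R]_k) a b) @ nbhs pi -->
    (pi : 'M[R]_k) a b.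
  exact: orthogonal_coord_continuous.
rewrite /continuous_at; move: (nbhs pi) FF Fpi => F FF Fpi.
apply: cvg_big => [|i _]; first exact: add_continuous.
pose sq (q : Defs.orthogonal R k) : R := \sum_(a < k)
  (e i a ord0 - \sum_(b < k) (q : 'M[R]_k) a b * e (s i) b ord0) ^+ 2.
(* The norm is non-negative, so an absolute value may be inserted. *)
have powE q : euclidean_norm (e i - (q : Defs.orthogonal R k) *m e (s i)) `^ p =
    `|Num.sqrt (sq q)| `^ p.
  rewrite (ger0_norm (sqrtr_ge0 _)); congr (Num.sqrt _ `^ p).
  by apply: eq_bigr => a _; rewrite !mxE.
under eq_fun do rewrite powE.
rewrite powE.
apply: (@cvg_comp _ _ _ (fun q => Num.sqrt (sq q)) (fun x : R => `|x| `^ p) F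
  (nbhs (Num.sqrt (sq pi)))); last exact: powR_norm_continuous.
apply: (@cvg_comp _ _ _ sq Num.sqrt F (nbhs (sq pi))); last first.
  exact: sqrt_continuous.
apply: cvg_big => [|a _]; first exact: add_continuous.
suff rowF : (fun q : Defs.orthogonal R k =>
    e i a ord0 - \sum_(b < k) (q : 'M[R]_k) a b * e (s i) b ord0) @ F -->
    e i a ord0 - \sum_(b < k) (pi : 'M[R]_k) a b * e (s i) b ord0.
  by apply: cvgM; exact: rowF.
apply: cvgB; first exact: cvg_cst.
apply: cvg_big => [|b _]; first exact: add_continuous.
by apply: cvgM; [exact: Fpi|exact: cvg_cst].
Qed.

(** * The Wasserstein distance and approximate symmetries *)

(** A bijection [gamma] matters only through its values on the points, and there
    it is [e i |-> pi (e (s i))] for a unique permutation [s]. *)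
Lemma bijection_costsE pi :
  [set \sum_(x \in range e) euclidean_norm (x - gamma x) `^ p
     | gamma in set_bij (range e) (orthogonal_image pi (range e))] =
  range (matching_cost p e pi).
Proof.
have sumE gamma s : (forall i, gamma (e i) = (pi : 'M[R]_k) *m e (s i)) ->
    \sum_(x \in range e) euclidean_norm (x - gamma x) `^ p =
    matching_cost p e pi s.
  move=> gE; rewrite (@reindex_fsbig _ _ _ _ _ e setT); last first.
    split=> [i _|i j _ _|//]; [by exists i|exact: e_inj].
  rewrite /matching_cost; under [RHS]eq_bigr do rewrite -gE.
  rewrite [RHS]fsbig_seq ?index_enum_uniq//.
  by apply: eq_fsbigl; apply/seteqP; split=> // i _ /=; rewrite mem_index_enum.
apply/seteqP; split=> [_ [gamma [gX gI _] <-]|_ [s _ <-]].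
  have /choice[t tE] : forall i, exists j, gamma (e i) = (pi : 'M[R]_k) *m e j.
    move=> i; have [_ [j _ <-] <-] : orthogonal_image pi (range e) (gamma (e i)).
      by apply: gX; exists i.
    by exists j.
  have t_inj : injective t.
    move=> i j tij; apply: e_inj; apply: gI.
    - by apply/mem_set; exists i.
    - by apply/mem_set; exists j.
    - by rewrite !tE tij.
  by exists (perm t_inj) => //; apply/esym/sumE => i; rewrite permE.
(* Points off the configuration are sent to 0. *)
have /choice[gamma gE] : forall x, exists y,
    forall i, x = e i -> y = (pi : 'M[R]_k) *m e (s i).
  move=> x; have [[i ->]|nx] := pselect (exists i, x = e i).
    by exists (pi *m e (s i)) => j /e_inj ->.
  by exists 0 => i xi; exfalso; apply: nx; exists i.
exists gamma; last by apply: sumE => i; exact: gE.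
split=> [_ [i _ <-]|x y|_ [_ [i _ <-] <-]].
- by rewrite (gE _ i)//; exists (e (s i)) => //; exists (s i).
- move=> /set_mem[i _ <-] /set_mem[j _ <-]; rewrite (gE _ i)// (gE _ j)//.
  move=> /(congr1 (mulmx (pi : 'M[R]_k)^T)).
  by rewrite !mulmxA !orthogonal_mulVmx !mul1mx => /e_inj/perm_inj ->.
- exists (e ((s^-1)%g i)); first by exists ((s^-1)%g i).
  by rewrite (gE _ ((s^-1)%g i))// permKV.
Qed.

(** The reduction of the Wasserstein distance to finitely many explicit
    functions of [pi]: an infimum over finitely many values is attained. *)
Lemma asymmetry_leP pi {eps : R} : 0 <= eps ->
  asymmetry p (range e) pi <= eps <->
  exists s, matching_cost p e pi s <= eps `^ p.
Proof.
move=> eps0; rewrite /asymmetry /wasserstein bijection_costsE.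
have p0 := ltW p_gt0; have pV0 : 0 <= p^-1 by rewrite invr_ge0.
have p_neq0 : p != 0 by rewrite gt_eqF.
have leE x : 0 <= x -> x `^ p^-1 <= eps <-> x <= eps `^ p.
  move=> x0; split=> [/(ge0_ler_powR p0)|/(ge0_ler_powR pV0)].
    by rewrite !nnegrE powR_ge0 -powRrM mulVf// powRr1//; exact.
  by rewrite !nnegrE powR_ge0 -powRrM mulfV// powRr1//; exact.
have [s0 s0E s0min] := inf_range_attained (1%g : {perm 'I_n}) (matching_cost p e pi).
rewrite s0E leE ?matching_cost_ge0//; split=> [|[s]]; first by exists s0.
exact: le_trans.
Qed.

Lemma approximate_symmetries_closed eps : 0 <= eps ->
  closed (approximate_symmetries p eps (range e)).
Proof.
move=> eps0.
have -> : approximate_symmetries p eps (range e) =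
    \bigcup_(s in [set: {perm 'I_n}])
      (matching_cost p e ^~ s @^-1` [set x | x <= eps `^ p]).
  apply/seteqP; split=> [pi /(asymmetry_leP _ eps0)[s ?]|pi [s _ ?]].
    by exists s.
  by apply/(asymmetry_leP _ eps0); exists s.
apply: closed_bigcup => [|s _]; first exact: finite_finset.
apply: (preimage_closed _ (@closed_le _ _)) => pi _.
exact: matching_cost_continuous.
Qed.

Lemma approximate_symmetries1 eps : 0 <= eps ->
  approximate_symmetries p eps (range e) 1%g.
Proof.
move=> eps0; apply/(asymmetry_leP _ eps0).
by exists 1%g; rewrite matching_cost11 powR_ge0.
Qed.

Lemma approximate_symmetriesV eps : 0 <= eps ->
  approximate_symmetries p eps (range e) =
  [set pi^-1%g | pi in approximate_symmetries p eps (range e)].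
Proof.
move=> eps0.
have symV pi : approximate_symmetries p eps (range e) pi ->
    approximate_symmetries p eps (range e) pi^-1%g.
  move=> /(asymmetry_leP _ eps0)[s cs]; apply/(asymmetry_leP _ eps0).
  by exists s^-1%g; rewrite matching_costV.
apply/seteqP; split=> [pi /symV ?|_ [pi /symV ? <-]//].
by exists pi^-1%g; rewrite ?invgK.
Qed.

(** The matchings of cost zero compose, whereas for positive [eps] the triangle
    inequality only bounds the asymmetry of a product by [2 * eps]. *)
Lemma exact_symmetriesM pi1 pi2 :
  approximate_symmetries p 0 (range e) pi1 ->
  approximate_symmetries p 0 (range e) pi2 ->
  approximate_symmetries p 0 (range e) (pi1 * pi2)%g.
Proof.
have exactP pi : approximate_symmetries p 0 (range e) pi <->
    exists s, matching_cost p e pi s = 0.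
  apply: (iff_trans (asymmetry_leP _ (lexx 0))); rewrite powR0 ?gt_eqF//.
  split=> -[s cs]; exists s; last by rewrite cs.
  by apply/eqP; rewrite eq_le cs matching_cost_ge0.
move=> /exactP[s1 c1] /exactP[s2 c2]; apply/exactP.
by exists (s1 * s2)%g; exact: matching_cost_eq0M.
Qed.

(** Near the identity, matching each point with its own image is already cheap
    enough. *)
Lemma approximate_symmetries_nbhs1 eps : 0 < eps ->
  nbhs (1%g : Defs.orthogonal R k) (approximate_symmetries p eps (range e)).
Proof.
move=> eps0; have FF : Filter (nbhs (1%g : Defs.orthogonal R k)).
  exact: nbhs_filter.
have : \forall pi \near (1%g : Defs.orthogonal R k),
    matching_cost p e pi 1%g < eps `^ p.
  apply: (cvgr_lt _ (matching_cost_continuous 1%g 1%g)).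
  by rewrite matching_cost11 powR_gt0.
apply: filterS => pi cpi; apply/(asymmetry_leP _ (ltW eps0)).
by exists 1%g; exact: ltW.
Qed.

End matchings.

Theorem theorem2p3p6 (R : realType) (k n : nat) (p : R) (X : set 'cV[R]_k)
    (eps : R) :
  1 <= p -> configuration n X -> centroid n X = 0 -> 0 <= eps ->
  exists K : nat,
    compact_approximate_subgroup K (approximate_symmetries p eps X).
Proof.
move=> p1 /configuration_enum[e e_inj ->] _ eps0.
have p_gt0 : 0 < p by exact: lt_le_trans p1.
have Sc : compact (approximate_symmetries p eps (range e)).
  apply: (subclosed_compact _ (@orthogonal_compact R k)) => //.
  exact: approximate_symmetries_closed.
have [eps_eq0|eps_neq0] := eqVneq eps 0.
  exists 1%N; apply: compact_subgroup_approximate_subgroup.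
  - exact: Sc.
  - exact: approximate_symmetries1.
  - exact: approximate_symmetriesV.
  - by rewrite eps_eq0; exact: exact_symmetriesM.
apply: compact_nbhs1_approximate_subgroup.
- exact: Sc.
- by apply: approximate_symmetries_nbhs1; rewrite // lt_neqAle eq_sym eps_neq0.
- exact: approximate_symmetriesV.
Qed.
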